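(* Let $\mu>0$ be fixed and let $f\in C([0,1])$. Then for every $n\in\mathbb{N}$, $n\ge1$, $$\Vert \mathscr{L}_n f-f\Vert_\infty\le \ln(2+\mu)\;\omega\!\left(f_\mu,\frac{1}{\sqrt n}\right)\left(2+\sqrt{n}\,\gamma_n\right),$$ where $\gamma_n:=\max_{x\in[0,1]}(a_n(x)-x)$.
   Context: Fix a real parameter $\mu>0$. Put $\ln_\mu(x):=\ln(1+\mu+x)$ for $x\in[0,1]$, and for $n\in\mathbb{N}$, $n\ge 1$, and $0\le k\le n$ put $p_{n,k}(y):=\binom{n}{k}y^k(1-y)^{n-k}$ and $$a_n(x):=\frac{\ln\left(1+\frac{x}{n(1+\mu)}\right)}{\ln\left(1+\frac{1}{n(1+\mu)}\right)},\qquad x\in[0,1].$$ For a bounded function $f:[0,1]\to\mathbb{R}$, define $$\mathscr{L}_n f(x)=\mathscr{L}_n(f,x):=\ln_\mu(x)\sum_{k=0}^n \frac{f(k/n)}{\ln_\mu(k/n)}\,p_{n,k}(a_n(x)),\qquad x\in[0,1],$$ and $f_\mu(x):=f(x)/\ln_\mu(x)$. $\Vert\cdot\Vert_\infty$ is the sup norm on $[0,1]$. For $g\in C([0,1])$ and $\delta>0$, the modulus of continuity is $\omega(g,\delta):=\sup\{|g(x)-g(y)|: x,y\in[0,1],\ |x-y|\le\delta\}$. *)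

(* Defs.v *)
From mathcomp Require Import all_boot all_order all_algebra.
From mathcomp Require Import all_classical all_reals all_analysis.
From mathcomp Require Import lra.

Set Implicit Arguments.
Unset Strict Implicit.
Unset Printing Implicit Defensive.

Import Order.TTheory GRing.Theory Num.Theory numFieldNormedType.Exports.

Local Open Scope classical_set_scope.
Local Open Scope ring_scope.

(* Functions on [0, 1] are total functions R -> R of which only the values on
   [0, 1] matter. Suprema are taken in R, where [sup] is 0 on sets without a
   supremum; [has_sup_norm], [has_sup_modulus], [gammaP],
   [continuous_Lop] and [continuous_f_] below show that this default is never used for
   continuous [f]. *)
Section Definitions.
Variable R : realType.
Implicit Types (mu x y delta : R) (f g : R -> R) (n k : nat).

Definition sup_norm g : R := sup [set `|g x| | x in `[0, 1]].

Definition modulus g delta : R :=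
  sup [set `|g p.1 - g p.2| | p in
        [set p : R * R | [/\ p.1 \in `[0, 1], p.2 \in `[0, 1]
                           & `|p.1 - p.2| <= delta]]].

Definition ln_mu mu x : R := ln (1 + mu + x).

Definition bernstein n k y : R := 'C(n, k)%:R * y ^+ k * (1 - y) ^+ (n - k).

Definition a_ mu n x : R :=
  ln (1 + x / (n%:R * (1 + mu))) / ln (1 + 1 / (n%:R * (1 + mu))).

Definition Lop mu n f x : R :=
  ln_mu mu x *
  \sum_(k < n.+1) f (k%:R / n%:R) / ln_mu mu (k%:R / n%:R)
                  * bernstein n k (a_ mu n x).

Definition f_ mu f x : R := f x / ln_mu mu x.

Definition gamma_ mu n : R := sup [set a_ mu n x - x | x in `[0, 1]].

End Definitions.

Section WellDefined.
Variable R : realType.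
Implicit Types (mu x y delta : R) (f g : R -> R) (n k : nat).

Lemma within_bounded g : {within `[0, 1], continuous g} ->
  exists M, forall x, x \in `[0, 1] -> `|g x| <= M.
Proof.
move=> cg.
have [c _ hc] := EVT_max (ler01 : (0 : R) <= 1) cg.
have [d _ hd] := EVT_min (ler01 : (0 : R) <= 1) cg.
exists (`|g c| + `|g d|) => x x01.
have := hc x x01; have := hd x x01.
have := ler_norm (g c); have := ler_norm (- g d); rewrite normrN.
have := normr_ge0 (g c); have := normr_ge0 (g d).
by rewrite ler_norml => *; apply/andP; split; lra.
Qed.

Lemma has_sup_norm g : {within `[0, 1], continuous g} ->
  has_sup [set `|g x| | x in `[0, 1]].
Proof.
move=> /within_bounded[M hM]; split.
  by exists `|g 0|, 0 => //=; rewrite in_itv /= lexx ler01.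
by exists M => _ [x x01 <-]; exact: hM.
Qed.

Lemma has_sup_modulus g delta : 0 < delta -> {within `[0, 1], continuous g} ->
  has_sup [set `|g p.1 - g p.2| | p in
        [set p : R * R | [/\ p.1 \in `[0, 1], p.2 \in `[0, 1]
                           & `|p.1 - p.2| <= delta]]].
Proof.
move=> d0 /within_bounded[M hM]; split.
  exists `|g 0 - g 0|, (0, 0) => //=.
  by split; rewrite ?in_itv /= ?lexx ?ler01// subrr normr0 ltW.
exists (M + M) => _ [[x y] [/= x01 y01 _] <-].
by rewrite (le_trans (ler_normB _ _))// lerD// hM.
Qed.

Lemma continuous_ln_mu mu x : 0 < mu -> x \in `[0, 1] ->
  {for x, continuous (ln_mu mu)}.
Proof.
move=> mu0; rewrite in_itv /= => /andP[x0 x1].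
apply: (@continuous_comp _ _ _ (fun x => 1 + mu + x) (@ln R)).
  by apply: cvgD; [exact: cvg_cst|exact: cvg_id].
by apply: continuous_ln; lra.
Qed.

Lemma continuous_a mu n x : 0 < mu -> (1 <= n)%N -> x \in `[0, 1] ->
  {for x, continuous (a_ mu n)}.
Proof.
move=> mu0 n1; rewrite in_itv /= => /andP[x0 x1].
have d0 : 0 < n%:R * (1 + mu) by rewrite mulr_gt0 ?ltr0n// addr_gt0.
apply: cvgM; last exact: cvg_cst.
apply: (@continuous_comp _ _ _ (fun x => 1 + x / (n%:R * (1 + mu))) (@ln R)).
  by apply: cvgD; [exact: cvg_cst|apply: cvgM; [exact: cvg_id|exact: cvg_cst]].
by apply: continuous_ln; rewrite ltr_wpDr// divr_ge0// ltW.
Qed.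

Lemma gammaP mu n : 0 < mu -> (1 <= n)%N ->
  exists2 x, x \in `[0, 1] & gamma_ mu n = a_ mu n x - x /\
    forall y, y \in `[0, 1] -> a_ mu n y - y <= a_ mu n x - x.
Proof.
move=> mu0 n1.
have cg : {within `[0, 1], continuous (fun x => a_ mu n x - x)}.
  apply: continuous_in_subspaceT => x; rewrite inE => x01.
  apply: cvgB; [exact: continuous_a|exact: cvg_id].
have [c c01 hc] := EVT_max (ler01 : (0 : R) <= 1) cg.
exists c => //; split=> //; apply/eqP; rewrite eq_le; apply/andP; split.
  apply: ge_sup; first by exists (a_ mu n c - c), c.
  by move=> _ [y y01 <-]; exact: hc.
apply: ub_le_sup; last by exists c.
by exists (a_ mu n c - c) => _ [y y01 <-]; exact: hc.
Qed.

Lemma continuous_Lop mu n f : 0 < mu -> (1 <= n)%N ->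
  {within `[0, 1], continuous (Lop mu n f)}.
Proof.
move=> mu0 n1; apply: continuous_in_subspaceT => x; rewrite inE => x01.
apply: cvgM; first exact: continuous_ln_mu.
apply: cvg_big => [|k _]; first exact: add_continuous.
apply: cvgM; first exact: cvg_cst.
have ca := continuous_a mu0 n1 x01.
apply: cvgM; first (apply: cvgM; first exact: cvg_cst).
  by apply: (@continuous_comp _ _ _ (a_ mu n) (fun y => y ^+ k)) => //;
    exact: exprn_continuous.
apply: (@continuous_comp _ _ _ (fun x => 1 - a_ mu n x) (fun y => y ^+ (n - k))).
  by apply: cvgB; [exact: cvg_cst|exact: ca].
exact: exprn_continuous.
Qed.

Lemma continuous_f_ mu f : 0 < mu -> {within `[0, 1], continuous f} ->
  {within `[0, 1], continuous (f_ mu f)}.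
Proof.
move=> mu0 cf x.
have cl : {within `[0, 1], continuous (fun y => (ln_mu mu y)^-1)}.
  apply: continuous_in_subspaceT => y; rewrite inE => y01.
  apply: cvgV; last exact: continuous_ln_mu.
  move: y01; rewrite /= in_itv /= => /andP[y0 y1].
  by rewrite gt_eqF// ln_gt0//; lra.
by apply: cvgM; [exact: cf|exact: cl].
Qed.

End WellDefined.

(* Main.v *)
(** [L_n f - f] equals [ln_mu] times [B_n f_mu (a_n x) - f_mu x], where [B_n]
    is the Bernstein operator. For a modulus of continuity,
    [|g s - g x| <= (1 + |s - x| / delta) * omega g delta]; with
    [delta = 1 / sqrt n], averaging over [s = k / n] against the Bernstein
    weights at [y = a_n x] costs [sqrt n * |y - x| <= sqrt n * gamma_n]
    (as [a_n x >= x] by concavity of [ln]) plus [sqrt n] times the mean of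
    [|k / n - y|], which the variance [y (1 - y) / n] bounds by [1]. *)
Require Import Defs.
From mathcomp Require Import all_boot all_order all_algebra.
From mathcomp Require Import all_classical all_reals all_analysis.
From mathcomp Require Import ring lra.
Import Order.TTheory GRing.Theory Num.Theory numFieldNormedType.Exports.
Local Open Scope classical_set_scope.
Local Open Scope ring_scope.

Lemma bernsteinS (R : realType) n k (y : R) : (k <= n)%N ->
  bernstein n.+1 k.+1 y = y * bernstein n k y + (1 - y) * bernstein n k.+1 y.
Proof.
rewrite /bernstein binS natrD subSS leq_eqVlt => /predU1P[->|kn].
  by rewrite bin_small// exprS; ring.
by rewrite -[(n - k)%N]prednK ?subn_gt0// -subnS !exprS; ring.
Qed.

Lemma bernstein_ge0 (R : realType) n k (y : R) : y \in `[0, 1] ->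
  0 <= bernstein n k y.
Proof.
rewrite in_itv /= => /andP[y0 y1].
by rewrite !mulr_ge0 ?exprn_ge0 ?subr_ge0.
Qed.

(** Conditioning on one Bernoulli trial: a binomial variable for [n.+1] is one for [n], shifted by 1
    with probability [y]. The moments below follow from it by induction on [n]. *)
Lemma sum_bernsteinS (R : realType) n (y : R) (F : nat -> R) :
  \sum_(k < n.+2) F k * bernstein n.+1 k y =
  y * (\sum_(k < n.+1) F k.+1 * bernstein n k y)
  + (1 - y) * (\sum_(k < n.+1) F k * bernstein n k y).
Proof.
have -> : \sum_(k < n.+1) F k * bernstein n k y =
    \sum_(k < n.+2) F k * bernstein n k y.
  (* The extra term vanishes because ['C(n, n.+1)] is 0. *)
  by rewrite [RHS]big_ord_recr /= {3}/bernstein bin_small// !mul0r mulr0 addr0.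
rewrite !(big_ord_recl n.+1) /= mulrDr addrCA; congr +%R.
  by rewrite /bernstein !bin0 !expr0 !subn0 exprS; ring.
rewrite !mulr_sumr -big_split /=; apply: eq_bigr => k _.
by rewrite /bump /= !add1n bernsteinS; [ring | rewrite -ltnS].
Qed.

Lemma sum_bernstein (R : realType) n (y : R) :
  \sum_(k < n.+1) bernstein n k y = 1.
Proof.
under eq_bigr do rewrite -[bernstein _ _ _]mul1r.
elim: n => [|n IHn]; last by rewrite (sum_bernsteinS _ _ _ (fun=> 1)) IHn; ring.
by rewrite big_ord1 /bernstein bin0 !expr0; ring.
Qed.

(** Variance plus squared bias. The centre [c] is arbitrary because the induction step needs the
    formula at both [c] and [c - 1]. *)
Lemma sum_bernstein_sqr (R : realType) n (y c : R) :
  \sum_(k < n.+1) (k%:R - c) ^+ 2 * bernstein n k y =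
  n%:R * y * (1 - y) + (n%:R * y - c) ^+ 2.
Proof.
elim: n c => [|n IHn] c.
  by rewrite big_ord1 /bernstein bin0 !expr0 /=; ring.
rewrite (sum_bernsteinS _ _ _ (fun k => (k%:R - c) ^+ 2)) IHn.
have -> : \sum_(k < n.+1) (k.+1%:R - c) ^+ 2 * bernstein n k y =
    \sum_(k < n.+1) (k%:R - (c - 1)) ^+ 2 * bernstein n k y.
  by apply: eq_bigr => k _; rewrite -natr1; congr (_ ^+ 2 * _); ring.
by rewrite IHn -natr1; ring.
Qed.

(** A pointwise quadratic bound, in place of Cauchy-Schwarz, reduces the mean absolute deviation to
    the variance. *)
Lemma sum_bernstein_dist (R : realType) n (y : R) : (1 <= n)%N ->
  y \in `[0, 1] ->
  \sum_(k < n.+1) `|k%:R / n%:R - y| * bernstein n k y <= 1 / Num.sqrt n%:R.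
Proof.
move=> n1 y01; set s := Num.sqrt n%:R.
have n0 : (0 : R) < n%:R by rewrite ltr0n.
have s0 : 0 < s by rewrite sqrtr_gt0.
have s2 : n%:R = s ^+ 2 by rewrite sqr_sqrtr// ltW.
(* AM-GM: [|t| <= ((s t) ^ 2 + 1) / (2 s)]. *)
have amgm k : `|k%:R / n%:R - y| <=
    ((k%:R - n%:R * y) ^+ 2 / n%:R + 1) / (2 * s).
  rewrite ler_pdivlMr ?mulr_gt0//.
  have -> : (k%:R - n%:R * y) ^+ 2 / n%:R = (s * `|k%:R / n%:R - y|) ^+ 2.
    by rewrite exprMn real_normK ?num_real// -s2; field; lra.
  by have := sqr_ge0 (s * `|k%:R / n%:R - y| - 1); nra.
apply: (le_trans (y := \sum_(k < n.+1)
    ((k%:R - n%:R * y) ^+ 2 * bernstein n k y / (n%:R * (2 * s))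
     + bernstein n k y / (2 * s)))).
  apply: ler_sum => k _.
  have -> : (k%:R - n%:R * y) ^+ 2 * bernstein n k y / (n%:R * (2 * s))
      + bernstein n k y / (2 * s) =
      ((k%:R - n%:R * y) ^+ 2 / n%:R + 1) / (2 * s) * bernstein n k y.
    by field; lra.
  by rewrite ler_wpM2r ?bernstein_ge0.
rewrite big_split /= -!mulr_suml sum_bernstein sum_bernstein_sqr.
rewrite subrr expr0n addr0 /=.
(* The crude bound [y * (1 - y) <= 1] makes the first factor at most 1. *)
have -> : n%:R * y * (1 - y) / (n%:R * (2 * s)) + 1 / (2 * s) =
    (y * (1 - y) + 1) / 2 * (1 / s) by field; lra.
rewrite ler_piMl ?divr_ge0 ?ltW//.
by move: y01; rewrite in_itv /= => /andP[]; nra.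
Qed.

Lemma le_modulus (R : realType) (g : R -> R) (delta x y : R) : 0 < delta ->
  {within `[0, 1], continuous g} -> x \in `[0, 1] -> y \in `[0, 1] ->
  `|x - y| <= delta -> `|g x - g y| <= modulus g delta.
Proof.
move=> d0 cg x01 y01 xy; apply: ub_le_sup; last by exists (x, y).
by have [] := has_sup_modulus d0 cg.
Qed.

Lemma modulus_ge0 (R : realType) (g : R -> R) (delta : R) : 0 < delta ->
  {within `[0, 1], continuous g} -> 0 <= modulus g delta.
Proof.
move=> d0 cg; have m01 : (0 : R) \in `[0, 1] by rewrite in_itv /= lexx ler01.
by apply: le_trans (normr_ge0 _) (le_modulus _ _ _ _ _ d0 cg m01 m01 _);
  rewrite subrr normr0 ltW.
Qed.

(** Cut the segment from [x] to [y] into [m.+1] equal pieces, each of length at most [delta]; the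
    induction peels off the piece at [x]. *)
Lemma le_natmul_modulus (R : realType) (g : R -> R) (delta : R) m (x y : R) :
  0 < delta -> {within `[0, 1], continuous g} ->
  x \in `[0, 1] -> y \in `[0, 1] ->
  `|x - y| <= m.+1%:R * delta -> `|g x - g y| <= m.+1%:R * modulus g delta.
Proof.
move=> d0 cg; elim: m x => [|m IHm] x x01 y01 xy.
  by move: xy; rewrite !mul1r; exact: le_modulus.
have m0 : (0 : R) < m.+2%:R by rewrite ltr0n.
have m1 : (1 : R) <= m.+2%:R by rewrite ler1n.
have mS : (m.+2%:R : R) = m.+1%:R + 1 by rewrite natr1.
pose t : R := m.+2%:R^-1.
have t0 : 0 < t by rewrite invr_gt0.
have t1 : t <= 1 by rewrite invf_le1.
have tm : t * m.+2%:R = 1 by rewrite mulVf ?gt_eqF.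
(* First of the division points into [m.+2] equal pieces; [m.+1] pieces remain between [z] and
   [y]. *)
pose z := x + t * (y - x).
have z01 : z \in `[0, 1].
  move: x01 y01; rewrite !in_itv /= => /andP[x0 x1] /andP[y0 y1].
  by apply/andP; split; rewrite /z; nra.
have xz : `|x - z| <= delta.
  have -> : x - z = t * (x - y) by rewrite /z; ring.
  rewrite normrM gtr0_norm//.
  by apply: le_trans (ler_wpM2l (ltW t0) xy) _; rewrite mulrA tm mul1r.
have zy : `|z - y| <= m.+1%:R * delta.
  have -> : z - y = t * m.+1%:R * (x - y).
    have -> : t * m.+1%:R = 1 - t.
      by move: tm; rewrite mS mulrDr mulr1 => /(canRL (addrK _)).
    by rewrite /z; ring.
  rewrite normrM ger0_norm ?mulr_ge0 ?(ltW t0)//.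
  rewrite [t * _]mulrC -mulrA ler_wpM2l//.
  by apply: le_trans (ler_wpM2l (ltW t0) xy) _; rewrite mulrA tm mul1r.
rewrite mS mulrDl mul1r [leRHS]addrC.
have -> : g x - g y = (g x - g z) + (g z - g y) by ring.
by rewrite (le_trans (ler_normD _ _))// lerD// ?IHm// le_modulus.
Qed.

(** With [m] the integer part of [|x - y| / delta], [m.+1] pieces suffice, and [m.+1] is at most
    [1 + |x - y| / delta]. *)
Lemma le_mul_modulus (R : realType) (g : R -> R) (delta x y : R) : 0 < delta ->
  {within `[0, 1], continuous g} -> x \in `[0, 1] -> y \in `[0, 1] ->
  `|g x - g y| <= (1 + `|x - y| / delta) * modulus g delta.
Proof.
move=> d0 cg x01 y01.
have q0 : 0 <= `|x - y| / delta by rewrite divr_ge0 // ltW.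
have /andP[mq qm] := truncn_itv q0.
apply: (@le_trans _ _
    ((Num.truncn (`|x - y| / delta)).+1%:R * modulus g delta)).
  by apply: le_natmul_modulus => //; rewrite -ler_pdivrMr// ltW.
by rewrite ler_wpM2r ?modulus_ge0// -natr1 addrC lerD2l.
Qed.

Lemma bernstein_approx (R : realType) (g : R -> R) n (x y : R) : (1 <= n)%N ->
  {within `[0, 1], continuous g} -> x \in `[0, 1] -> y \in `[0, 1] ->
  `|\sum_(k < n.+1) g (k%:R / n%:R) * bernstein n k y - g x| <=
  modulus g (1 / Num.sqrt n%:R) * (2 + Num.sqrt n%:R * `|y - x|).
Proof.
move=> n1 cg x01 y01; set s := Num.sqrt n%:R; set w := modulus g _.
have s0 : 0 < s by rewrite sqrtr_gt0 ltr0n.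
have d0 : 0 < 1 / s by rewrite divr_gt0.
have w0 : 0 <= w by exact: modulus_ge0.
have -> : g x = \sum_(k < n.+1) g x * bernstein n k y.
  by rewrite -mulr_sumr sum_bernstein mulr1.
rewrite -sumrB; apply: le_trans (ler_norm_sum _ _ _) _.
(* The triangle inequality through [y] splits [|k / n - x|] into a part free of [k], which meets
   total mass 1, and a part that averages to the mean absolute deviation. *)
apply: (@le_trans _ _ (\sum_(k < n.+1)
   ((1 + s * `|y - x|) * w * bernstein n k y
    + s * w * (`|k%:R / n%:R - y| * bernstein n k y)))).
  apply: ler_sum => k _; have p0 := bernstein_ge0 _ n k _ y01.
  rewrite -mulrBl normrM (ger0_norm p0) [X in _ <= _ + X]mulrA -mulrDl.
  rewrite ler_wpM2r//.
  have k01 : (k%:R / n%:R : R) \in `[0, 1].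
    rewrite in_itv /= divr_ge0// ler_pdivrMr ?ltr0n// mul1r.
    by rewrite ler_nat -ltnS ltn_ord.
  apply: le_trans (le_mul_modulus _ _ _ _ _ d0 cg k01 x01) _.
  rewrite -/w; set u := `|_ - x|.
  have -> : u / (1 / s) = s * u by field; lra.
  have : u <= `|y - x| + `|k%:R / n%:R - y|.
    by rewrite addrC /u (le_trans _ (ler_normD _ _))// addrA subrK.
  move=> /(ler_wpM2l (ltW s0)) /(ler_wpM2r w0); lra.
rewrite big_split /= -!mulr_sumr sum_bernstein.
(* This part contributes at most [w], raising the constant from 1 to 2. *)
have /(ler_wpM2l (mulr_ge0 (ltW s0) w0)) := sum_bernstein_dist _ _ _ n1 y01.
have -> : s * w * (1 / s) = w by field; lra.
by rewrite -/s; lra.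
Qed.

(** Concavity of [ln] between 1 and [1 + 1 / d]: the point [1 + x / d] puts weight [x] on the second
    endpoint, and [ln 1 = 0]. *)
Lemma a_ge (R : realType) (mu : R) n (x : R) : 0 < mu -> (1 <= n)%N ->
  x \in `[0, 1] -> x <= a_ mu n x.
Proof.
move=> mu0 n1 x01; rewrite /a_.
set d := n%:R * (1 + mu).
have d0 : 0 < d by rewrite mulr_gt0 ?ltr0n// addr_gt0.
have t0 : 0 < 1 / d by rewrite divr_gt0.
rewrite ler_pdivlMr ?ln_gt0 ?ltrDl//.
move: x01; rewrite in_itv /= => /andP[x0 x1].
have := @concave_ln R (Itv01 x0 x1) _ _ (addr_gt0 ltr01 t0) ltr01.
rewrite !convRE /= ln1 mulr0 addr0; congr (_ <= ln _).
by rewrite /unstable.onem; field; lra.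
Qed.

(** Ensures that the Bernstein weights at [a_ mu n x] are nonnegative. The upper bound is
    monotonicity of [ln]. *)
Lemma a_itv (R : realType) (mu : R) n (x : R) : 0 < mu -> (1 <= n)%N ->
  x \in `[0, 1] -> a_ mu n x \in `[0, 1].
Proof.
move=> mu0 n1 x01; have ax := a_ge _ _ _ _ mu0 n1 x01.
move: (x01); rewrite !in_itv /= => /andP[x0 x1].
rewrite (le_trans x0 ax) /= /a_; set d := n%:R * (1 + mu).
have d0 : 0 < d by rewrite mulr_gt0 ?ltr0n// addr_gt0.
have t0 : 0 < 1 / d by rewrite divr_gt0.
have xd0 : 0 <= x / d by rewrite divr_ge0 // ltW.
rewrite ler_pdivrMr ?ln_gt0 ?ltrDl// [leRHS]mul1r.
rewrite ler_ln ?posrE ?ltr_wpDr ?(ltW t0)//.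
by rewrite lerD2l ler_pM2r ?invr_gt0.
Qed.

Theorem theorem4p1 (R : realType) (mu : R) (mu_gt0 : 0 < mu) (f : R -> R)
    (f_cont : {within `[0, 1], continuous f}) (n : nat) (n_ge1 : (1 <= n)%N) :
  sup_norm (fun x => Lop mu n f x - f x) <=
    ln (2 + mu) * modulus (f_ mu f) (1 / Num.sqrt n%:R)
      * (2 + Num.sqrt n%:R * gamma_ mu n).
Proof.
have cg := continuous_f_ mu_gt0 f_cont.
have d0 : 0 < 1 / Num.sqrt (n%:R : R) by rewrite divr_gt0// sqrtr_gt0 ltr0n.
apply: ge_sup => [|_ [x x01 <-]].
  by exists `|Lop mu n f 0 - f 0|, 0 => //=; rewrite in_itv /= lexx ler01.
have ax := a_ge _ _ _ _ mu_gt0 n_ge1 x01.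
have gax : a_ mu n x - x <= gamma_ mu n.
  by have [c _ [-> hc]] := gammaP mu_gt0 n_ge1; exact: hc.
have := x01; rewrite /= in_itv /= => /andP[x0 x1].
(* Positivity, from [1 + mu + x > 1], lets [ln_mu mu x] cancel against the denominator of
   [f_ mu f x]. *)
have l0 : 0 < ln_mu mu x by rewrite ln_gt0//; lra.
have l2 : ln_mu mu x <= ln (2 + mu) by rewrite ler_ln ?posrE; lra.
have -> : Lop mu n f x - f x = ln_mu mu x *
    (\sum_(k < n.+1) f_ mu f (k%:R / n%:R) * bernstein n k (a_ mu n x)
     - f_ mu f x).
  by rewrite mulrBr; congr (_ - _); rewrite /f_ mulrC divfK ?gt_eqF.
rewrite normrM gtr0_norm// -mulrA ler_pM ?(ltW l0)//.
have a01 := a_itv _ _ _ _ mu_gt0 n_ge1 x01.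
apply: le_trans (bernstein_approx _ _ _ _ _ n_ge1 cg x01 a01) _.
(* It remains to bound [|a_ mu n x - x|] by [gamma_ mu n]; since [x <= a_ mu n x], the absolute
   value drops. *)
rewrite ler_wpM2l ?modulus_ge0// lerD2l ler_wpM2l ?sqrtr_ge0//.
by rewrite ger0_norm// subr_ge0.
Qed.
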